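(* Let $\theta>0$ be a constant such that $\|T_N(E)\|\le N^\theta$ for all integers $N\ge2$ and all $E\in\Sigma_\lambda$. Then for every $\xi\in(0,\dim_H\Sigma_\lambda)$ there is a constant $C_\xi>0$ such that for all $N\ge2$, $$\mathcal{I}(N)=\int_{-\infty}^{\infty}\frac{dE}{\|T_N(E)\|^2}\ge\frac{C_\xi}{N^{(\frac1\xi-1)+2\theta}}.$$
   Context: Fibonacci Hamiltonian: fix $\lambda>0$ and $\alpha=\frac{\sqrt5-1}{2}$. The potential is $v(n)=-\lambda\chi_{[1-\alpha,1)}(n\alpha \bmod 1)$, $n\in\mathbb{Z}$ (the phase $\omega=0$ case of $v_\omega(n)=-\lambda\chi_{[1-\alpha,1)}(\omega+n\alpha\bmod1)$). $\Sigma_\lambda\subset\mathbb{R}$ denotes the spectrum of the corresponding discrete Schrödinger operator $(h\psi)(n)=-\psi(n+1)-\psi(n-1)+v(n)\psi(n)$ on $\ell^2(\mathbb{Z})$; it has Hausdorff dimension $\dim_H\Sigma_\lambda\in(0,1)$. $T_N(E)=A_N(E)\cdots A_1(E)$ with $A_n(E)=\begin{pmatrix}v(n)-E&-1\\1&0\end{pmatrix}$, and $\|\cdot\|$ is the operator norm. *)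

(* Defs.v *)
From HB Require Import structures.
From mathcomp Require Import all_boot all_order all_algebra.
From mathcomp Require Import all_classical all_reals all_analysis.
Set Implicit Arguments. Unset Strict Implicit. Unset Printing Implicit Defensive.
Import Order.TTheory GRing.Theory Num.Theory.
Import numFieldNormedType.Exports.
Local Open Scope classical_set_scope.
Local Open Scope ring_scope.

Section Fib.
Variable R : realType.

Definition fib_alpha : R := (Num.sqrt 5 - 1) / 2.

Definition frac (x : R) : R := x - (Num.floor x)%:~R.

(* Fibonacci potential, phase omega = 0:
   v(n) = - lambda * chi_[1-alpha,1)(n alpha mod 1) *)
Definition fib_pot (lambda : R) (n : int) : R :=
  let x := frac (n%:~R * fib_alpha) in
  if (1 - fib_alpha <= x) && (x < 1) then - lambda else 0.

Definition l2 (u : int -> R) : Prop :=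
  exists M : R, forall n : nat,
    \sum_(i < n) (u (i%:Z) ^+ 2 + u (- (i%:Z) - 1) ^+ 2) <= M.

Definition fib_hE (lambda E : R) (psi : int -> R) : int -> R :=
  fun n => - psi (n + 1) - psi (n - 1) + fib_pot lambda n * psi n - E * psi n.

Definition hE_bijective_l2 (lambda E : R) : Prop :=
  (forall u w, l2 u -> l2 w -> fib_hE lambda E u = fib_hE lambda E w -> u = w) /\
  (forall f, l2 f -> exists2 u, l2 u & fib_hE lambda E u = f).

(* spectrum Sigma_lambda (a subset of R, since h is self-adjoint) *)
Definition fib_spectrum (lambda : R) : set R :=
  [set E | ~ hE_bijective_l2 lambda E].

Definition transfer_A (lambda E : R) (n : int) : 'M[R]_2 :=
  \matrix_(i < 2, j < 2)
    (if (i == 0 :> nat) then (if (j == 0 :> nat) then fib_pot lambda n - E else -1)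
     else (if (j == 0 :> nat) then 1 else 0)).

Fixpoint transfer (lambda E : R) (N : nat) : 'M[R]_2 :=
  match N with
  | 0 => 1%:M
  | N'.+1 => transfer_A lambda E (N'.+1)%:Z *m transfer lambda E N'
  end.

Definition eucl2 (v : 'cV[R]_2) : R := Num.sqrt (v 0 0 ^+ 2 + v 1 0 ^+ 2).

Definition opnorm (M : 'M[R]_2) : R :=
  sup [set eucl2 (M *m v) | v in [set v : 'cV[R]_2 | eucl2 v = 1]].

Definition ediam (U : set R) : \bar R :=
  ereal_sup [set (`|x - y|)%:E | x in U & y in U].

Definition hweight (s : R) (U : set R) : \bar R :=
  if asbool (U = set0) then 0%E else ((fine (ediam U)) `^ s)%:E.

Definition hausdorff_pre (s delta : R) (A : set R) : \bar R :=
  ereal_inf [set (\sum_(0 <= i <oo) hweight s (U i))%E | U in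
     [set U : nat -> set R | A `<=` \bigcup_i U i /\
                             forall i, (ediam (U i) <= delta%:E)%E]].

Definition hausdorff_measure (s : R) (A : set R) : \bar R :=
  ereal_sup [set hausdorff_pre s delta A | delta in [set d : R | 0 < d]].

Definition hausdorff_dim (A : set R) : \bar R :=
  ereal_inf [set s%:E | s in [set s : R | 0 <= s /\ hausdorff_measure s A = 0%E]].

End Fib.

(* Main.v *)
Require Import Defs.
From HB Require Import structures.
From mathcomp Require Import all_boot all_order all_algebra.
From mathcomp Require Import all_classical all_reals all_analysis.
From mathcomp Require Import ring lra zify.
Set Implicit Arguments. Unset Strict Implicit. Unset Printing Implicit Defensive.
Import Order.TTheory GRing.Theory Num.Theory.
Import numFieldNormedType.Exports.
Local Open Scope classical_set_scope.
Local Open Scope ring_scope.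

(** Fix $N$ and let $S$ be the set of energies $E\in[-K,K]$ at which the squared Hilbert-Schmidt
    norm of $T_N(E)$ is at most $2N^{2\theta}$. This norm lies between the operator norm and
    $\sqrt2$ times it, so $S$ contains $\Sigma_\lambda$, and the integrand is at least
    $\frac12N^{-2\theta}$ on $S$. It remains to bound $|S|$ from below by a multiple of
    $N^{1-1/\xi}$.

    The squared Hilbert-Schmidt norm is a polynomial in $E$ of degree at most $2N$
    ([hsnorm2_transfer_poly]), so $S$ is covered by $O(N)$ intervals $I$ of total length at most
    $|S|$ ([poly_sublevel_cover]). They also cover $\Sigma_\lambda$, and since
    $\xi<\dim_H\Sigma_\lambda$ they satisfy $\sum|I|^\xi\ge c$ with $c>0$ independent of $N$
    ([hausdorff_content_gt0]). For $\xi<1$, few intervals with a large sum of $\xi$-powers must have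
    a large total length ([sum_ge_of_sum_powR_ge]); this yields the factor $N^{1-1/\xi}$.

    Boundedness of $\Sigma_\lambda$, which gives $K$, follows from the growth hypothesis at $N=2$
    ([energy_bound]); with it, $\xi<1$ follows from [hausdorff_dim_bounded_le1]. *)

(** * Hausdorff measure and dimension through finite covers by intervals *)

Lemma ediam_itvcc (R : realType) (a b : R) : a <= b ->
  ediam `[a, b] = (b - a)%:E.
Proof.
move=> ab; apply/eqP; rewrite eq_le; apply/andP; split.
  apply: ge_ereal_sup => _ [x /= xab [y /= yab <-]].
  move: xab yab; rewrite !in_itv /= => /andP[ax xb] /andP[ay yb].
  by rewrite lee_fin ler_norml; apply/andP; split; lra.
apply: ereal_sup_ubound; exists b => /=; first by rewrite in_itv /= ab lexx.
exists a; first by rewrite /= in_itv /= lexx.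
by rewrite ger0_norm // subr_ge0.
Qed.

Lemma ediam_set0 (R : realType) : ediam (set0 : set R) = -oo%E.
Proof.
rewrite /ediam (_ : [set _ | _ in _ & _ in _] = set0) ?ereal_sup0 //.
by apply/seteqP; split=> // z [].
Qed.

Lemma hweight_itvcc (R : realType) (s a b : R) : a <= b ->
  hweight s `[a, b] = ((b - a) `^ s)%:E.
Proof.
move=> ab; rewrite /hweight ediam_itvcc //; case: ifPn => // /asboolP ab0.
have : `[a, b]%classic a by rewrite /= in_itv /= lexx.
by rewrite ab0.
Qed.

Lemma hweight_set0 (R : realType) (s : R) : hweight s (set0 : set R) = 0%E.
Proof. by rewrite /hweight; case: ifPn => // /asboolP. Qed.

Lemma hweight_ge0 (R : realType) (s : R) (U : set R) : (0 <= hweight s U)%E.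
Proof. by rewrite /hweight; case: ifP => // _; rewrite lee_fin powR_ge0. Qed.

Lemma hausdorff_pre_ge0 (R : realType) (s delta : R) (A : set R) :
  (0 <= hausdorff_pre s delta A)%E.
Proof.
apply: le_ereal_inf_tmp => _ [U _ <-].
by apply: nneseries_ge0 => n _ _; exact: hweight_ge0.
Qed.

(** The covers carry no bound on the diameters: a small sum of $s$-powers already makes every single
    interval short. *)
Lemma hausdorff_measure_eq0 (R : realType) (s : R) (A : set R) : 0 < s ->
  (forall e : R, 0 < e -> exists2 L : seq (R * R),
     (all (fun p => p.1 <= p.2) L /\
      forall x, A x -> has (fun p => p.1 <= x <= p.2) L) &
     \sum_(p <- L) (p.2 - p.1) `^ s <= e) ->
  hausdorff_measure s A = 0%E.
Proof.
move=> s0 cover; apply/eqP; rewrite eq_le; apply/andP; split; last first.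
  apply: (@le_trans _ _ (hausdorff_pre s 1 A)); first exact: hausdorff_pre_ge0.
  by apply: ereal_sup_ubound; exists 1 => //=.
apply: ge_ereal_sup => _ [d /= d0 <-]; apply/lee_addgt0Pr => e e0.
rewrite add0e.
(* Capping the sum by $d^s$ forces each length to be at most $d$, so the cover is admissible at
   scale $d$. *)
have e'0 : 0 < Num.min e (d `^ s) by rewrite lt_min e0 powR_gt0.
have [L [/allP Lle LA] Lsum] := cover _ e'0.
have /andP[Le Ld] : (\sum_(p <- L) (p.2 - p.1) `^ s <= e) &&
    (\sum_(p <- L) (p.2 - p.1) `^ s <= d `^ s) by rewrite -le_min.
pose u k := nth (0, 0) L k.
have uL k : (k < size L)%N -> u k \in L by exact: mem_nth.
(* The finite cover is padded to a sequence by empty sets, which have diameter $-\infty$ and weight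
   $0$. *)
pose U k : set R := if (k < size L)%N then `[(u k).1, (u k).2]%classic else set0.
apply: (@le_trans _ _ (\sum_(0 <= i <oo) hweight s (U i))%E).
  apply: ereal_inf_lbound; exists U => //=; split.
    move=> x /LA /(has_nthP (0, 0))[k kL xk].
    by exists k => //; rewrite /U kL /= in_itv.
  move=> k; rewrite /U; case: ifPn => kL; last by rewrite ediam_set0 leNye.
  have uk := Lle _ (uL _ kL).
  rewrite ediam_itvcc // lee_fin leNgt; apply/negP => dk.
  have : d `^ s < ((u k).2 - (u k).1) `^ s.
    by apply: gt0_ltr_powR; rewrite // nnegrE ?ltW // (lt_trans d0 dk).
  apply/negP; rewrite -leNgt; apply: le_trans Ld.
  rewrite (big_rem _ (uL _ kL)) /= lerDl sumr_ge0 // => i _.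
  exact: powR_ge0.
rewrite (nneseries_split 0 (size L)); last by move=> k _; exact: hweight_ge0.
rewrite add0n [X in (_ + X)%E]eseries0; last first.
  by move=> i Li _; rewrite /U ltnNge Li hweight_set0.
rewrite adde0 big_nat_cond.
under eq_bigr => i /andP[/andP[_ iL] _].
  rewrite /U iL hweight_itvcc; last exact: Lle (uL _ iL).
  over.
by rewrite -big_nat_cond sumEFin lee_fin; move: Le; rewrite (big_nth (0, 0)).
Qed.

Lemma hausdorff_dim_le (R : realType) (s : R) (A : set R) :
  0 <= s -> hausdorff_measure s A = 0%E -> (hausdorff_dim A <= s%:E)%E.
Proof. by move=> s0 sA; apply: ereal_inf_lbound; exists s. Qed.

(** Otherwise finite covers would have arbitrarily small $s$-sums, the $s$-measure would vanish, and
    the dimension would be at most $s$. The constant depends on [A] and [s] alone, which makes the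
    final bound uniform in $N$. *)
Lemma hausdorff_content_gt0 (R : realType) (s : R) (A : set R) :
  0 < s -> (s%:E < hausdorff_dim A)%E ->
  exists2 c : R, 0 < c & forall L : seq (R * R),
    all (fun p => p.1 <= p.2) L ->
    (forall x, A x -> has (fun p => p.1 <= x <= p.2) L) ->
    c <= \sum_(p <- L) (p.2 - p.1) `^ s.
Proof.
move=> s0 sA; apply: contrapT => noc.
move: sA; apply/negP; rewrite -leNgt; apply: hausdorff_dim_le; first exact: ltW.
apply: hausdorff_measure_eq0 => // e e0; apply: contrapT => noL.
apply: noc; exists e => // L L1 L2; rewrite leNgt; apply/negP => Le.
by apply: noL; exists L => //; exact: ltW.
Qed.

(** Cutting $[-K,K]$ into $n$ equal pieces gives the $(1+e)$-sum $(2K)^{1+e}n^{-e}$, which tends to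
    $0$. *)
Lemma hausdorff_dim_bounded_le1 (R : realType) (K : R) (A : set R) :
  0 < K -> (forall x, A x -> - K <= x < K) -> (hausdorff_dim A <= 1)%E.
Proof.
move=> K0 AK; apply/lee_addgt0Pr => e e0; rewrite -EFinD.
apply: hausdorff_dim_le; first by rewrite addr_ge0 // ltW.
apply: hausdorff_measure_eq0 => [|d d0]; first by rewrite addr_gt0.
(* Chosen so that $n\ge M$ is equivalent to $(2K)^{1+e}n^{-e}\le d$. *)
pose M := ((2 * K) `^ (1 + e) / d) `^ e^-1.
have M0 : 0 <= M by exact: powR_ge0.
pose n := (Num.truncn M).+1.
have n0 : 0 < n%:R :> R by rewrite ltr0n.
have nM : M <= n%:R by rewrite ltW // truncnS_gt.
pose a k : R := - K + k%:R * (2 * K / n%:R).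
exists [seq (a k, a k.+1) | k <- iota 0 n].
  split.
    apply/allP => _ /mapP[k _ ->] /=.
    rewrite /a lerD2l ler_pM2r ?ler_nat //.
    by rewrite divr_gt0 // mulr_gt0.
  move=> x /AK /andP[xK Kx].
  have y0 : 0 <= (x + K) * n%:R / (2 * K).
    by rewrite divr_ge0 // mulr_ge0 ?(ltW K0) //; lra.
  set y := _ / _ in y0.
  have /andP[ky yk] := truncn_itv y0.
  have xE : x = - K + y * (2 * K / n%:R).
    by rewrite /y; field; rewrite !gt_eqF.
  have h0 : 0 < 2 * K / n%:R by rewrite divr_gt0 // mulr_gt0.
  apply/hasP; exists (a (Num.truncn y), a (Num.truncn y).+1).
    apply: map_f; rewrite mem_iota add0n leq0n /= -(ltr_nat R).
    apply: le_lt_trans ky _.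
    rewrite /y ltr_pdivrMr ?mulr_gt0 // mulrC ltr_pM2l //; lra.
  by rewrite /a /= [in X in X && _]xE [in X in _ && X]xE !lerD2l !ler_pM2r // ky ltW.
rewrite big_map.
under eq_bigr => k _.
  rewrite /= (_ : a k.+1 - a k = 2 * K / n%:R); last first.
    by rewrite /a -natr1; ring.
  over.
rewrite big_const_seq count_predT size_iota iter_addr_0 -[_ *+ n]mulr_natl.
have n0' := ltW n0; have K0' := ltW K0.
rewrite powRM ?mulr_ge0 ?invr_ge0 //.
rewrite -[n%:R^-1]powR_inv1 // -powRrM mulN1r powRN.
rewrite [n%:R `^ (1 + e)]powRD; last by rewrite (gt_eqF n0) implybT.
rewrite (powRr1 n0') invfM mulrCA mulVKf ?gt_eqF //.
rewrite ler_pdivrMr ?powR_gt0 // [d * _]mulrC -ler_pdivrMr //.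
rewrite [X in X <= _](_ : _ = M `^ e); last first.
  rewrite /M -powRrM mulVf ?gt_eqF //.
  by rewrite powRr1 // divr_ge0 ?powR_ge0 // ltW.
by apply: ge0_ler_powR; rewrite ?nnegrE // ltW.
Qed.

(** * Covering polynomial sublevel sets by few intervals *)

Lemma poly_roots_seq (F : fieldType) (p : {poly F}) : p != 0 ->
  exists2 s : seq F, (size s < size p)%N & forall x, root p x -> x \in s.
Proof.
have [n] := ubnP (size p); elim: n p => // n IH p pn p0.
have [[c pc]|noc] := pselect (exists c, root p c); last first.
  exists [::]; first by rewrite size_poly_gt0.
  by move=> x px; case: noc; exists x.
have /factor_theorem[q pE] := pc.
have q0 : q != 0 by apply: contraNneq p0 => q0; rewrite pE q0 mul0r.
have sp : size p = (size q).+1.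
  by rewrite pE size_Mmonic ?monicXsubC // size_XsubC addn2.
have [|s sq sr] := IH q _ q0; first by rewrite sp ltnS in pn.
exists (c :: s); first by rewrite /= sp ltnS.
move=> x; rewrite pE rootM root_XsubC inE orbC.
by case/orP=> [->//|/sr ->]; rewrite orbT.
Qed.

Lemma measurable_sublevel (R : realType) (p : {poly R}) (a b : R) :
  measurable ([set x | a <= x <= b] `&` [set x | p.[x] <= 0]).
Proof.
rewrite (_ : [set x | a <= x <= b] = `[a, b]%classic); last first.
  by apply/seteqP; split=> x /=; rewrite in_itv.
apply: measurableI => //; apply: measurable_realfun.closed_measurable.
apply: (@preimage_closed R R (horner p) [set y | y <= 0]); last exact: closed_le.
by move=> x _; exact: continuous_horner.
Qed.

(** Induction on the number of candidate roots: split at an interior root, which lies in neither of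
    the two remaining candidate lists. Without an interior root the sign of [p] is constant inside,
    and either the whole interval or its two endpoints suffice; this accounts for the bound
    $2(|s|+1)$. *)
Lemma sublevel_cover (R : realType) (p : {poly R}) (s : seq R) (a b : R) :
  a <= b -> (forall x, a < x < b -> root p x -> x \in s) ->
  exists2 L : seq (R * R),
    [/\ all (fun i => i.1 <= i.2) L, (size L <= 2 * (size s).+1)%N &
        forall x, a <= x <= b -> p.[x] <= 0 ->
          has (fun i => i.1 <= x <= i.2) L] &
    ((\sum_(i <- L) (i.2 - i.1))%:E <= lebesgue_measure
       ([set x | a <= x <= b] `&` [set x | p.[x] <= 0])%R)%E.
Proof.
have [n] := ubnP (size s); elim: n s a b => // n IH s a b sn ab rs.
have [[c acb pc]|noc] := pselect (exists2 c, a < c < b & root p c).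
  have /andP[ac cb] := acb.
  pose s1 := [seq x <- s | x < c]; pose s2 := [seq x <- s | c < x].
  have ss : (size s1 + size s2 < size s)%N.
    have cs := rs _ acb pc.
    rewrite /s1 /s2 !size_filter.
    rewrite (perm_size (perm_to_rem cs)) /= ltnS -[leqRHS](count_predC (fun x => x < c)).
    have cE r : count r s = (r c + count r (rem c s))%N.
      by rewrite (permP (perm_to_rem cs)).
    rewrite !cE ltxx !add0n leq_add2l; apply: sub_count => x /=.
    by rewrite -leNgt => /ltW.
  have [||L1 [L1le L1s L1c] L1m] := IH s1 a c _ (ltW ac).
  - exact: leq_ltn_trans (leq_addr _ _) (leq_trans ss (ltnSE sn)).
  - move=> x /andP[ax xc] px; rewrite mem_filter xc rs // ax /=.
    exact: lt_trans cb.
  have [||L2 [L2le L2s L2c] L2m] := IH s2 c b _ (ltW cb).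
  - exact: leq_ltn_trans (leq_addl _ _) (leq_trans ss (ltnSE sn)).
  - move=> x /andP[cx xb] px; rewrite mem_filter cx rs // xb andbT.
    exact: lt_trans cx.
  exists (L1 ++ L2).
    split; first by rewrite all_cat L1le.
      rewrite size_cat (leq_trans (leq_add L1s L2s)) // -mulnDr leq_mul2l /=.
      by rewrite addSn addnS ltnS.
    move=> x /andP[ax xb] px; rewrite has_cat.
    have [xc|cx] := leP x c; first by rewrite L1c ?ax.
    by rewrite L2c ?orbT // xb ltW.
  rewrite big_cat /= EFinD; apply: le_trans (leeD L1m L2m) _.
  set A1 := [set x | a <= x <= c] `&` _; set A2 := [set x | c <= x <= b] `&` _.
  have mA1 : measurable A1 by exact: measurable_sublevel.
  have mA2 : measurable A2 by exact: measurable_sublevel.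
  have mA2' : measurable (A2 `\` [set c]) by apply: measurableD.
  (* The halves meet at most in the null set $\{c\}$; removing it makes them disjoint, so their
     measures add up. *)
  have -> : lebesgue_measure A2 = lebesgue_measure (A2 `\` [set c]).
    apply/eqP; rewrite eq_le; apply/andP; split; last first.
      by apply: le_measure; rewrite ?inE // => x [].
    apply: (@le_trans _ _ (lebesgue_measure ((A2 `\` [set c]) `|` [set c]))).
      apply: le_measure; rewrite ?inE //; first exact: measurableU.
      move=> x A2x; have [->|/eqP xc] := eqVneq x c; first by right.
      by left.
    apply: (le_trans (measureU2 _ _ _)) => //.
    rewrite [X in (_ + X)%E](_ : _ = 0%E) ?adde0 //.
    exact: lebesgue_measure_set1.
  rewrite -measureU //; last first.
    apply/seteqP; split => // x [[/= /andP[_ xc] _] [[/= /andP[cx _] _]]].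
    by apply; apply/eqP; rewrite eq_le xc.
  apply: le_measure; rewrite ?inE //; first exact: measurableU.
    exact: measurable_sublevel.
  move=> x [[/= /andP[ax xc] px]|[[/= /andP[cx xb] px] _]]; split=> //=.
    by rewrite ax (le_trans xc) // ltW.
  by rewrite xb andbT (le_trans _ cx) // ltW.
have sgn_const x y : a < x -> x < y -> y < b -> (p.[x] <= 0) = (p.[y] <= 0).
  move=> ax xy yb.
  have nr z : x <= z <= y -> p.[z] != 0.
    move=> /andP[xz zy]; apply/negP => pz; apply: noc; exists z => //.
    by rewrite (lt_le_trans ax xz) (le_lt_trans zy yb).
  have ivt (q : {poly R}) : q.[x] <= 0 <= q.[y] -> exists2 z, x <= z <= y & q.[z] = 0.
    by move=> /(poly_ivt (ltW xy))[z zxy /rootP qz]; exists z.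
  have [px|px] := leP p.[x] 0; have [py|py] := leP p.[y] 0 => //.
    have [|z /nr + pz0] := ivt p; first by rewrite px ltW.
    by rewrite pz0 eqxx.
  have [|z /nr + pz0] := ivt (- p).
    by rewrite !hornerN oppr_le0 oppr_ge0 py ltW.
  by rewrite -oppr_eq0 -hornerN pz0 eqxx.
have [[m /andP[am mb] pm]|pos] := pselect (exists2 m, a < m < b & p.[m] <= 0).
  exists [:: (a, b)]; first by split=> /=; rewrite ?ab // => x ->.
  rewrite big_seq1 /=.
  apply: (@le_trans _ _ (lebesgue_measure (`]a, b[%classic : set R))).
    rewrite lebesgue_measure_itv /= lte_fin; have [//|ba] := ltP.
    by rewrite lee_fin; lra.
  apply: le_measure; rewrite ?inE //; first exact: measurable_sublevel.
  move=> x /=; rewrite in_itv /= => /andP[ax xb]; split; first by rewrite /= !ltW.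
  rewrite /=; have [xm|mx|->] := ltgtP x m => //.
    by rewrite (sgn_const x m).
  by rewrite -(sgn_const m x).
(* No interior point satisfies $p\le0$, so degenerate intervals of length $0$ at the endpoints are
   enough. *)
exists [:: (a, a); (b, b)]; last first.
  by rewrite big_cons big_seq1 /= !subrr addr0.
split; rewrite /= ?lexx //; first by rewrite mulnS.
move=> x /andP[ax xb] px.
rewrite orbF -!eq_le.
have [//|ax'] := eqVneq a x; have [//|xb'] := eqVneq x b.
by exfalso; apply: pos; exists x; rewrite // !lt_neqAle ax' ax xb' xb.
Qed.

Lemma poly_sublevel_cover (R : realType) (p : {poly R}) (a b : R) :
  a <= b -> exists2 L : seq (R * R),
    [/\ all (fun i => i.1 <= i.2) L, (size L <= 2 * (size p).+1)%N &
        forall x, a <= x <= b -> p.[x] <= 0 ->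
          has (fun i => i.1 <= x <= i.2) L] &
    ((\sum_(i <- L) (i.2 - i.1))%:E <= lebesgue_measure
       ([set x | a <= x <= b] `&` [set x | p.[x] <= 0])%R)%E.
Proof.
move=> ab; have [->|/poly_roots_seq[s sp rs]] := eqVneq p 0; last first.
  have [x _|L [L1 L2 L3] L4] := @sublevel_cover R p s a b ab; first exact: rs.
  exists L => //; split=> //; rewrite (leq_trans L2) // leq_mul2l /= ltnS.
  exact: ltnW.
exists [:: (a, b)]; first by split=> /=; rewrite ?ab ?muln_gt0 // => x ->.
rewrite big_seq1 /= (_ : _ `&` _ = `[a, b]%classic); last first.
  apply/seteqP; split=> x /=; rewrite in_itv /= ?horner0 ?lexx //.
  by case.
rewrite lebesgue_measure_itv /= lte_fin; have [//|ba] := ltP.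
by rewrite lee_fin; lra.
Qed.

                                                                               
                                             
(** * From a sum of $\xi$-powers to a total length *)

(** Up to a constant this is Hölder's inequality, obtained by a cut-off at [M] with $M^\xi=c/(2m)$.
    Terms at most [M] contribute at most $c/2$ in all; a larger $x$ satisfies $x^\xi\le
    xM^{\xi-1}$. *)
Lemma sum_ge_of_sum_powR_ge (R : realType) (xi c : R) (m : nat) (l : seq R) :
  0 < xi -> xi < 1 -> 0 < c -> (0 < m)%N -> (size l <= m)%N ->
  all (fun x => 0 <= x) l -> c <= \sum_(x <- l) x `^ xi ->
  c / 2 * (c / (2 * m%:R)) `^ (xi^-1 - 1) <= \sum_(x <- l) x.
Proof.
move=> xi0 xi1 c0 m0 lm /allP l0 cl.
have m0' : 0 < m%:R :> R by rewrite ltr0n.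
have r0 : 0 < c / (2 * m%:R) by rewrite divr_gt0 // mulr_gt0.
set r := c / (2 * m%:R) in r0 *.
pose M := r `^ xi^-1.
have M0 : 0 < M by exact: powR_gt0.
have Mxi : M `^ xi = r by rewrite /M -powRrM mulVf ?gt_eqF // powRr1 // ltW.
have step x : 0 <= x -> x `^ xi <= r + x * M `^ (xi - 1).
  move=> x0; have [xM|Mx] := leP x M.
    apply: (@le_trans _ _ (M `^ xi)).
      by apply: ge0_ler_powR; rewrite ?nnegrE // ltW.
    by rewrite Mxi lerDl mulr_ge0 // powR_ge0.
  rewrite -(mulr_powRB1 x0 xi0) (@le_trans _ _ (x * M `^ (xi - 1))) //.
    rewrite ler_wpM2l // -(opprB 1 xi) !powRN lef_pV2 ?posrE ?powR_gt0 //.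
      by apply: ge0_ler_powR; rewrite ?nnegrE ?subr_ge0 // ltW.
    exact: lt_trans Mx.
  by rewrite lerDr ltW.
have main : c <= c / 2 + (\sum_(x <- l) x) * M `^ (xi - 1).
  apply: (le_trans cl).
  apply: (@le_trans _ _ (\sum_(x <- l) (r + x * M `^ (xi - 1)))).
    by rewrite big_seq [leRHS]big_seq; apply: ler_sum => x /l0; exact: step.
  rewrite big_split /= mulr_suml; apply: lerD => //.
  rewrite big_const_seq count_predT iter_addr_0.
  rewrite -[r *+ _]mulr_natr (@le_trans _ _ (r * m%:R)) //.
    by rewrite ler_pM2l // ler_nat.
  by rewrite /r le_eqVlt; apply/orP; left; apply/eqP; field; rewrite gt_eqF.
have {}main : c / 2 <= (\sum_(x <- l) x) * M `^ (xi - 1) by lra.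
have -> : r `^ (xi^-1 - 1) = (M `^ (xi - 1))^-1.
  rewrite -powRN /M -powRrM; congr (_ `^ _); by field; rewrite gt_eqF.
by rewrite ler_pdivrMr // powR_gt0.
Qed.

(** * Operator norm against Hilbert-Schmidt norm *)

(** The squared Hilbert-Schmidt norm stands in for the squared operator norm because it is
    polynomial in the entries. *)
Definition hsnorm2 {R : realType} (M : 'M[R]_2) : R :=
  M 0 0 ^+ 2 + M 0 1 ^+ 2 + (M 1 0 ^+ 2 + M 1 1 ^+ 2).

Lemma ord2P (i : 'I_2) : {i = 0} + {i = 1}.
Proof. by case: i => [[|[|//]] h]; [left|right]; apply/val_inj. Qed.

Section OperatorNorm.
Context {R : realType}.
Implicit Type M : 'M[R]_2.

Lemma mulmx_cV2 M (v : 'cV[R]_2) i :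
  (M *m v) i 0 = M i 0 * v 0 0 + M i 1 * v 1 0.
Proof. by rewrite mxE big_ord_recl big_ord1 (_ : lift ord0 ord0 = 1) //; apply/val_inj. Qed.

Lemma hsnorm2_ge0 M : 0 <= hsnorm2 M.
Proof. by rewrite !addr_ge0 ?sqr_ge0. Qed.

Lemma eucl2_mulmx_le M (v : 'cV[R]_2) : eucl2 v = 1 ->
  eucl2 (M *m v) <= Num.sqrt (hsnorm2 M).
Proof.
move=> v1; have v2 : v 0 0 ^+ 2 + v 1 0 ^+ 2 = 1.
  by rewrite -[LHS]sqr_sqrtr ?addr_ge0 ?sqr_ge0 // -/(eucl2 v) v1 expr1n.
rewrite /eucl2 ler_sqrt ?hsnorm2_ge0 // !mulmx_cV2.
have cs (a b x y : R) : (a * x + b * y) ^+ 2 <= (a ^+ 2 + b ^+ 2) * (x ^+ 2 + y ^+ 2).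
  rewrite -subr_ge0 (_ : _ - _ = (a * y - b * x) ^+ 2) ?sqr_ge0 //; ring.
by apply: lerD; apply: le_trans (cs _ _ _ _) _; rewrite v2 mulr1.
Qed.

Lemma has_sup_opnorm M :
  has_sup [set eucl2 (M *m v) | v in [set v : 'cV[R]_2 | eucl2 v = 1]].
Proof.
split.
  exists (eucl2 (M *m delta_mx 0 0)); exists (delta_mx 0 0) => //=.
  by rewrite /eucl2 !mxE /= expr1n expr0n addr0 sqrtr1.
by exists (Num.sqrt (hsnorm2 M)) => _ [v /= v1 <-]; exact: eucl2_mulmx_le.
Qed.

Lemma opnorm_le_hsnorm M : opnorm M <= Num.sqrt (hsnorm2 M).
Proof.
apply: ge_sup; first by case: (has_sup_opnorm M).
by move=> _ [v /= v1 <-]; exact: eucl2_mulmx_le.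
Qed.

Lemma eucl2_col_le_opnorm M (j : 'I_2) :
  Num.sqrt (M 0 j ^+ 2 + M 1 j ^+ 2) <= opnorm M.
Proof.
apply: ub_le_sup; first by case: (has_sup_opnorm M).
exists (delta_mx j 0) => /=.
  by rewrite /eucl2 !mxE /=; case: (ord2P j) => ->; rewrite /= expr1n expr0n ?addr0 ?add0r sqrtr1.
by rewrite -colE /eucl2 !mxE.
Qed.

Lemma opnorm_ge0 M : 0 <= opnorm M.
Proof. exact: le_trans (sqrtr_ge0 _) (eucl2_col_le_opnorm M 0). Qed.

(** Each of the two columns is the image of a unit vector. *)
Lemma hsnorm2_le_opnorm M : hsnorm2 M <= 2 * opnorm M ^+ 2.
Proof.
have c j : M 0 j ^+ 2 + M 1 j ^+ 2 <= opnorm M ^+ 2.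
  rewrite -[leLHS]sqr_sqrtr ?addr_ge0 ?sqr_ge0 //.
  by rewrite lerXn2r ?nnegrE ?sqrtr_ge0 ?opnorm_ge0 // eucl2_col_le_opnorm.
rewrite /hsnorm2; have := c 0; have := c 1; lra.
Qed.

Lemma opnorm_gt0 M : M != 0 -> 0 < opnorm M.
Proof.
move=> Mn0; rewrite lt_def opnorm_ge0 andbT; apply/eqP => M0.
have h0 : hsnorm2 M <= 0.
  by apply: le_trans (hsnorm2_le_opnorm M) _; rewrite M0 expr0n mulr0.
have z (i j : 'I_2) : M i j = 0.
  apply/eqP; rewrite -sqrf_eq0 eq_le sqr_ge0 andbT; apply: le_trans h0.
  rewrite /hsnorm2.
  have := sqr_ge0 (M 0 0); have := sqr_ge0 (M 0 1).
  have := sqr_ge0 (M 1 0); have := sqr_ge0 (M 1 1).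
  by case: (ord2P i) => ->; case: (ord2P j) => ->; lra.
by case/eqP: Mn0; apply/matrixP => i j; rewrite z mxE.
Qed.

End OperatorNorm.

(** * Transfer matrices as functions of the energy *)

Section TransferMatrix.
Context {R : realType}.
Implicit Types (lambda E : R) (N : nat).

Lemma transferS lambda E N (j : 'I_2) :
  transfer lambda E N.+1 0 j = (fib_pot lambda N.+1%:Z - E) *
     transfer lambda E N 0 j - transfer lambda E N 1 j /\
  transfer lambda E N.+1 1 j = transfer lambda E N 0 j.
Proof.
have e1 : lift ord0 ord0 = 1 :> 'I_2 by apply/val_inj.
by split; rewrite /= mxE big_ord_recl big_ord1 e1 !mxE /=; ring.
Qed.

(** The recursion can be run backwards, so a vanishing $T_{N+1}$ would force $T_N=0$. This makes the
    operator norm positive, so that inverting it reverses inequalities. *)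
Lemma transfer_neq0 lambda E N : transfer lambda E N != 0.
Proof.
elim: N => [|N /eqP IH]; first exact: oner_neq0.
apply/eqP => TS; apply: IH; apply/matrixP => i j.
have [] := transferS lambda E N j; rewrite TS !mxE => + T0.
rewrite -T0 mulr0 add0r => /esym/eqP; rewrite oppr_eq0 => /eqP T1.
by case: (ord2P i) => ->; rewrite -?T0 ?T1.
Qed.

Lemma transfer_poly lambda N (j : 'I_2) : exists p q : {poly R},
  [/\ (size p <= N.+1)%N, (size q <= N.+1)%N &
      forall E, transfer lambda E N 0 j = p.[E] /\
                transfer lambda E N 1 j = q.[E]].
Proof.
elim: N => [|N [p [q [sp sq pqE]]]].
  exists (0 == j)%:R%:P, (1 == j)%:R%:P; split; rewrite ?size_polyC_leq1 // => E.
  by rewrite /= !mxE !hornerC.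
exists (((fib_pot lambda N.+1%:Z)%:P - 'X) * p - q), p; split.
- apply: leq_trans (size_polyD _ _) _; rewrite size_polyN geq_max.
  rewrite (leq_trans sq) ?andbT //.
  apply: leq_trans (size_polyMleq _ _) _.
  have s2 : (size ((fib_pot lambda N.+1)%:P - 'X)%R <= 2)%N.
    by rewrite -opprB size_polyN size_XsubC.
  by rewrite -subn1 leq_subLR; exact: leq_add s2 sp.
- exact: leq_trans sp _.
move=> E; have [-> ->] := transferS lambda E N j; have [-> ->] := pqE E.
by rewrite !hornerE.
Qed.

Lemma hsnorm2_transfer_poly lambda N : exists2 p : {poly R},
  (size p <= (2 * N).+1)%N & forall E, hsnorm2 (transfer lambda E N) = p.[E].
Proof.
have [p0 [q0 [sp0 sq0 E0]]] := transfer_poly lambda N 0.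
have [p1 [q1 [sp1 sq1 E1]]] := transfer_poly lambda N 1.
exists (p0 ^+ 2 + p1 ^+ 2 + (q0 ^+ 2 + q1 ^+ 2)); last first.
  move=> E; rewrite /hsnorm2; have [-> ->] := E0 E; have [-> ->] := E1 E.
  by rewrite !hornerE !expr2.
have sqr (p : {poly R}) : (size p <= N.+1 -> size (p ^+ 2) <= (2 * N).+1)%N.
  move=> sp; rewrite expr2 (leq_trans (size_polyMleq _ _)) //.
  by rewrite -subn1 leq_subLR add1n mul2n -addnn -addnS -addSn leq_add.
have add (p q : {poly R}) : (size p <= (2 * N).+1 -> size q <= (2 * N).+1 ->
    size (p + q)%R <= (2 * N).+1)%N.
  by move=> sp sq; rewrite (leq_trans (size_polyD _ _)) // geq_max sp.
by apply: (add); apply: add; apply: sqr.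
Qed.

Lemma fib_pot_bound lambda n : 0 < lambda -> `|fib_pot lambda n| <= lambda.
Proof.
by move=> l0; rewrite /fib_pot; case: ifP => _; rewrite ?normrN ?normr0 ?gtr0_norm // ltW.
Qed.

(** The lower left entry of $T_2(E)$ is $v(1)-E$, so a bound on $\|T_2(E)\|$ bounds $E$. *)
Lemma energy_bound lambda E : 0 < lambda ->
  `|E| <= lambda + opnorm (transfer lambda E 2).
Proof.
move=> l0; set T := transfer lambda E 2.
have T10 : T 1 0 = fib_pot lambda 1 - E.
  rewrite /T (transferS lambda E 1 0).2 (transferS lambda E 0 0).1 /= !mxE /=; ring.
have : `|T 1 0| <= opnorm T.
  apply: le_trans (eucl2_col_le_opnorm T 0).
  by rewrite -sqrtr_sqr ler_sqrt ?addr_ge0 ?sqr_ge0 // lerDr sqr_ge0.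
rewrite T10 => h.
have -> : E = fib_pot lambda 1 - (fib_pot lambda 1 - E) by ring.
by apply: le_trans (ler_normB _ _) _; rewrite lerD // fib_pot_bound.
Qed.

End TransferMatrix.

                                                                                    
                                                                           
(** * The lower bound for the integral *)

(** The integral of a nonnegative function is a supremum over simple functions below it, and
    $k\chi_A$ is one of them; only [A] has to be measurable. *)
Lemma ge0_integral_ge_cst (d : measure_display) (T : measurableType d)
    (R : realType) (mu : {measure set T -> \bar R}) (f : T -> R) (k : R)
    (A : set T) :
  0 <= k -> (forall x, 0 <= f x) -> measurable A ->
  (forall x, A x -> k <= f x) ->
  (k%:E * mu A <= \int[mu]_x (f x)%:E)%E.
Proof.
move=> k0 f0 mA kf; rewrite ge0_integralTE => [|x]; last by rewrite lee_fin.
apply: ereal_sup_ubound; exists (scale_nnsfun (indic_nnsfun R mA) k0).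
  move=> x; rewrite /= lee_fin /= /cst /= measurable_realfun.mindicE; have [xA|xA] := boolP (x \in A).
    by rewrite mulr1 kf //; rewrite inE in xA.
  by rewrite mulr0.
rewrite -integralT_nnsfun.
under eq_integral => x _ do rewrite /= /cst /=.
rewrite (integralZl_indic _ (fun=> A)) //; last by rewrite ltNge k0.
by rewrite integral_indic // setIT.
Qed.

Theorem theorem3p11 (R : realType) (lambda theta : R) :
  0 < lambda -> 0 < theta ->
  (forall (N : nat) (E : R), (2 <= N)%N -> fib_spectrum lambda E ->
     opnorm (transfer lambda E N) <= N%:R `^ theta) ->
  forall xi : R, 0 < xi -> (xi%:E < hausdorff_dim (fib_spectrum lambda))%E ->
  exists2 C : R, 0 < C &
    forall N : nat, (2 <= N)%N ->
      ((C / N%:R `^ ((xi^-1 - 1) + 2 * theta))%:E <=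
        \int[@lebesgue_measure R]_(E in [set: R])
           ((opnorm (transfer lambda E N)) ^-2)%:E)%E.
Proof.
move=> l0 _ hT xi xi0 xidim.
(* On the spectrum $|E|\le\lambda+\|T_2(E)\|\le\lambda+2^\theta$; the extra $1$ makes the upper
   bound strict. *)
pose K := lambda + 2 `^ theta + 1.
have K0 : 0 < K by have := powR_ge0 2 theta; rewrite /K; lra.
have specK E : fib_spectrum lambda E -> - K <= E < K.
  move=> /(hT 2%N E isT) hE; have := energy_bound E l0.
  by rewrite /K ler_norml => /andP[h1 h2]; apply/andP; split; lra.
have xi1 : xi < 1.
  by rewrite -lte_fin; apply: lt_le_trans xidim (hausdorff_dim_bounded_le1 K0 specK).
have [c c0 content] := hausdorff_content_gt0 xi0 xidim.
(* The $12$ comes from using at most $m=6N$ intervals in $c/(2m)$, the last factor $\frac12$ from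
   the integrand bound $(2N^{2\theta})^{-1}$. *)
exists (c / 2 * (c / 12) `^ (xi^-1 - 1) / 2).
  by rewrite divr_gt0 // mulr_gt0 ?powR_gt0 ?divr_gt0.
move=> N N2; have N0 : 0 < N%:R :> R by rewrite ltr0n ltnW.
have [p sp pE] := hsnorm2_transfer_poly lambda N.
pose Q := (N%:R `^ theta) ^+ 2.
have Q0 : 0 < Q by rewrite exprn_gt0 // powR_gt0.
pose q := p - (2 * Q)%:P.
have qE x : (q.[x] <= 0) = (hsnorm2 (transfer lambda x N) <= 2 * Q).
  by rewrite /q hornerD hornerN hornerC -pE subr_le0.
have sq : (size q <= (2 * N).+1)%N.
  rewrite (leq_trans (size_polyD _ _)) // geq_max sp size_polyN.
  by rewrite (leq_trans (size_polyC_leq1 _)).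
have KK : - K <= K by lra.
have [L [Lle Ls Lc] Lm] := poly_sublevel_cover q KK.
have sumL : c <= \sum_(i <- L) (i.2 - i.1) `^ xi.
  (* The intervals cover the spectrum, since there the squared Hilbert-Schmidt norm is at most
     $2\|T_N(E)\|^2\le2N^{2\theta}$. *)
  apply: content => // E sE; have /andP[E1 E2] := specK _ sE.
  apply: Lc; first by rewrite E1 ltW.
  rewrite qE; apply: le_trans (hsnorm2_le_opnorm _) _.
  by rewrite ler_pM2l // lerXn2r ?nnegrE ?opnorm_ge0 ?powR_ge0 // hT.
have sumL' : c / 2 * (c / (2 * (6 * N)%:R)) `^ (xi^-1 - 1) <=
    \sum_(i <- L) (i.2 - i.1).
  rewrite -(big_map (fun i : R * R => i.2 - i.1) xpredT id).
  apply: sum_ge_of_sum_powR_ge => //.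
  - by rewrite muln_gt0 /= ltnW.
  (* There are at most $2(2N+2)=4N+4$ intervals, and $4N+4\le6N$ because $N\ge2$. *)
  - rewrite size_map (leq_trans Ls) //; move: sq N2; lia.
  - by rewrite all_map; apply: sub_all Lle => i; rewrite /= subr_ge0.
  - by rewrite big_map.
pose S := ([set x | - K <= x <= K] `&` [set x | q.[x] <= 0] : set R).
have fS x : S x -> (2 * Q)^-1 <= opnorm (transfer lambda x N) ^- 2.
  move=> [_]; rewrite /= qE => hx.
  have o0 := opnorm_gt0 (transfer_neq0 lambda x N).
  rewrite lef_pV2 ?posrE ?exprn_gt0 ?(mulr_gt0 _ Q0) //; apply: le_trans _ hx.
  rewrite -[leRHS]sqr_sqrtr ?hsnorm2_ge0 //.
  by rewrite lerXn2r ?nnegrE ?sqrtr_ge0 ?opnorm_ge0 ?opnorm_le_hsnorm.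
have k0 : 0 <= (2 * Q)^-1 by rewrite invr_ge0 mulr_ge0 // ltW.
have f0 x : 0 <= opnorm (transfer lambda x N) ^- 2.
  by rewrite invr_ge0 exprn_ge0 ?opnorm_ge0.
have int_ge := ge0_integral_ge_cst lebesgue_measure k0 f0
  (measurable_sublevel q (- K) K) fS.
apply: le_trans _ int_ge.
apply: le_trans _ (lee_wpmul2l _ Lm); last by rewrite lee_fin.
rewrite -EFinM lee_fin; apply: le_trans _ (ler_wpM2l k0 sumL').
rewrite le_eqVlt; apply/orP; left; apply/eqP.
rewrite [N%:R `^ _]powRD ?(gt_eqF N0) ?implybT // [2 * theta]mulrC powRrM.
rewrite powR_mulrn ?powR_ge0 // -/Q.
rewrite (_ : c / (2 * (6 * N)%:R) = c / 12 * N%:R^-1); last first.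
  by rewrite natrM; field; rewrite gt_eqF.
rewrite [in RHS]powRM ?invr_ge0 ?divr_ge0 ?ltW //.
rewrite -(powR_inv1 (ltW N0)) -powRrM mulN1r powRN.
by field; rewrite !gt_eqF ?powR_gt0.
Qed.
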